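(* For any signed graph $(G,\sigma)$ such that $G$ contains $3$ edge-disjoint spanning trees, $\Phi_c(G,\sigma)<4$. In particular, $\Phi_c(G,\sigma)<4$ for every $6$-edge-connected signed graph $(G,\sigma)$.
   Context: Graphs are finite, may have multiple edges but no loops; a signed graph $(G,\sigma)$ has $\sigma:E(G)\to\{+,-\}$. For an orientation $D$ and $f:E(G)\to\mathbb{R}$, $\partial_Df(v)$ is the sum of $f$ over out-arcs at $v$ minus the sum over in-arcs. A circular $r$-flow ($r\ge2$) is a pair $(D,f)$ with $f:E(G)\to(-r,r)$ such that $|f(e)|\in[1,r-1]$ for positive edges, $|f(e)|\in[0,\frac r2-1]\cup[\frac r2+1,r)$ for negative edges, and $\partial_Df(v)=0$ at every vertex. The circular flow index $\Phi_c(G,\sigma)$ is the infimum of $r$ for which $(G,\sigma)$ admits a circular $r$-flow. *)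

(* Defs.v *)
From HB Require Import structures.
From mathcomp Require Import all_boot all_order all_algebra.
From mathcomp Require classical_sets reals ereal.
Set Implicit Arguments.
Unset Strict Implicit.
Unset Printing Implicit Defensive.

(* Finite loopless multigraphs: an edge is an element of [edge G], so parallel
   edges are distinct edges with the same two-element set of ends. *)
Record mgraph := MGraph {
  vertex : finType;
  edge : finType;
  ends : edge -> {set vertex};
  card_ends : forall e, #|ends e| = 2
}.

Definition adj (G : mgraph) (F : {set edge G}) : rel (vertex G) :=
  fun x y => [exists e in F, ends e == [set x; y]].

Definition connected_by (G : mgraph) (F : {set edge G}) : Prop :=
  forall x y : vertex G, connect (adj F) x y.

(* A cycle of length n.+1 is given by distinct vertices v_0, ..., v_n and
   distinct edges e_i joining v_i to its cyclic successor; a pair of parallel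
   edges is a cycle of length 2, and length 1 is excluded by [card_ends]. *)
Definition has_cycle (G : mgraph) (F : {set edge G}) : Prop :=
  exists (n : nat) (v : 'I_n.+1 -> vertex G) (e : 'I_n.+1 -> edge G),
    [/\ injective v, injective e, forall i, e i \in F
      & forall i, ends (e i) = [set v i; v (ordS i)]].

Definition spanning_tree (G : mgraph) (T : {set edge G}) : Prop :=
  connected_by T /\ ~ has_cycle T.

Definition has_disjoint_spanning_trees (G : mgraph) (k : nat) : Prop :=
  exists T : 'I_k -> {set edge G},
    (forall i, spanning_tree (T i)) /\
    (forall i j, i != j -> [disjoint T i & T j]).

Definition edge_connected (G : mgraph) (k : nat) : Prop :=
  forall F : {set edge G}, #|F| < k -> connected_by (~: F).

Inductive sign := Pos | Neg.

Record orientation (G : mgraph) := Orientation {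
  arc_tail : edge G -> vertex G;
  arc_head : edge G -> vertex G;
  ends_orientation : forall e, ends e = [set arc_tail e; arc_head e]
}.

Import reals ereal classical_sets.
Import Order.TTheory GRing.Theory Num.Theory.
Local Open Scope ring_scope.

Definition boundary (R : realType) (G : mgraph) (D : orientation G)
    (f : edge G -> R) (v : vertex G) : R :=
  \sum_(e | arc_tail D e == v) f e - \sum_(e | arc_head D e == v) f e.

Definition circular_flow (R : realType) (G : mgraph) (sigma : edge G -> sign)
    (r : R) (D : orientation G) (f : edge G -> R) : Prop :=
  [/\ forall e, - r < f e < r,
      forall e, match sigma e return Prop with
        | Pos => 1 <= `|f e| <= r - 1
        | Neg => 0 <= `|f e| <= r / 2 - 1 \/ r / 2 + 1 <= `|f e| < r
        end
    & forall v, boundary D f v = 0].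

(* Taken in the extended reals, so that a signed graph without any circular
   flow has index +oo (the real-valued [inf] of the empty set is 0). *)
Definition circular_flow_index (R : realType) (G : mgraph)
    (sigma : edge G -> sign) : \bar R :=
  ereal_inf [set r%:E | r in
    [set r : R | 2 <= r /\
                 exists (D : orientation G) (f : edge G -> R),
                   circular_flow sigma r D f]]%classic.

(* Main.v *)
Require Import Defs.
From mathcomp Require Import all_boot all_order all_algebra.
From mathcomp Require Import reals ereal.
From mathcomp Require Import zify lra.

(** Let T0, T1, T2 be disjoint connected spanning edge sets.  Adding to T0 a subset
    of T1 that repairs parities gives an even edge set H containing T0 and avoiding
    T2.  Adding to the positive edges outside H a subset of T0 that repairs parities
    gives an even edge set K.  If a and b are +-1 flows on H and K, then F = a + 2b
    is an integer flow that is odd and at most 3 in absolute value on H, is +-2 on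
    the positive edges outside H and 0 on the negative ones.  This is a circular
    4-flow whose only tight values lie on H.  For r = 4 - d, every edge of H
    prescribes in which direction r/4 F must move by d/4, and such a perturbation is
    completed to a flow inside T2, where there is slack.

    A 2k-edge-connected graph has k disjoint connected spanning edge sets by the
    exchange argument of matroid union: in an optimal partial k-colouring, the edges
    that can be made uncoloured by exchanges are spanned by those among them of each
    colour, and all other edges are coloured.  If these edges had q > 1 components,
    then fewer than kq edges would join different components, while 2k edges leave
    each of them. *)

Set Implicit Arguments.
Unset Strict Implicit.
Unset Printing Implicit Defensive.

(** * Spanned edges and components *)

Lemma orientation_exists (G : mgraph) : inhabited (orientation G).
Proof.
have P (e : edge G) : {xy | ends e == [set xy.1; xy.2]}.
  apply/sigW; have /eqP/cards2P[x [y [_ Exy]]] := card_ends e.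
  by exists (x, y); rewrite Exy.
apply: inhabits; exists (fun e => (sval (P e)).1) (fun e => (sval (P e)).2) => e.
exact/eqP/(svalP (P e)).
Qed.

Section Connectivity.
Variables (G : mgraph) (D : orientation G).
Implicit Types (A B F : {set edge G}) (e f : edge G) (x y : vertex G).

Local Notation conn A := (connect (adj A)).

Definition spanned A e := conn A (arc_tail D e) (arc_head D e).

Lemma adjP A x y :
  reflect (exists2 e, e \in A &
    (x = arc_tail D e /\ y = arc_head D e) \/
    (x = arc_head D e /\ y = arc_tail D e)) (adj A x y).
Proof.
apply: (iffP exists_inP) => [[e eA /eqP Ee]|[e eA xy]]; exists e => //.
  move: Ee; rewrite (ends_orientation D) => /setP E.
  have := E x; have := E y; have := E (arc_tail D e); have := E (arc_head D e).
  rewrite !inE !eqxx ?orbT /= => /esym hh /esym tt yy xx.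
  case/orP: xx => /eqP Ex; case/orP: yy => /eqP Ey; subst; [|by left|by right|].
  - by move: hh; rewrite orbb => /eqP hh; left; split; rewrite ?hh.
  - by move: tt; rewrite orbb => /eqP tt; left; split; rewrite ?tt.
rewrite (ends_orientation D); apply/eqP.
by case: xy => [[-> ->]|[-> ->]] //; rewrite setUC.
Qed.

Lemma conn_sym A : connect_sym (adj A).
Proof.
by apply: sym_connect_sym => x y; rewrite /adj; under eq_existsb => e do rewrite setUC.
Qed.

Lemma spanned_mem A e : e \in A -> spanned A e.
Proof. by move=> eA; apply/connect1/adjP; exists e => //; left. Qed.

Lemma conn_span A B x y :
  (forall e, e \in A -> spanned B e) -> conn A x y -> conn B x y.
Proof.
move=> AB; apply: (connect_sub (e := adj A)) => {x y} x y /adjP[e eA].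
by case=> -[-> ->]; [|rewrite conn_sym]; apply: AB.
Qed.

Lemma conn_mono A B x y : A \subset B -> conn A x y -> conn B x y.
Proof.
move=> /subsetP AB; apply: (connect_sub (e := adj A)) => {x y} x y.
by case/exists_inP=> e /AB eB Ee; apply/connect1/exists_inP; exists e.
Qed.

(** Cut a walk at its first and last use of [f]: if these run in opposite directions, [f] can be
    bypassed. *)
Lemma conn_setU1 A f x y : conn (f |: A) x y ->
  [\/ conn A x y,
      conn A x (arc_tail D f) /\ conn A (arc_head D f) y
    | conn A x (arc_head D f) /\ conn A (arc_tail D f) y].
Proof.
case/connectP=> p; elim: p x => [|z p IHp] x /=; first by move=> _ ->; constructor 1.
case/andP=> /adjP[e]; rewrite !inE => /predU1P[->|eA] xz zp yp; last first.
  have xz' : conn A x z by apply/connect1/adjP; exists e.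
  case: (IHp _ zp yp) => [zy|[zt hy]|[zh ty]].
  - by constructor 1; apply: connect_trans zy.
  - by constructor 2; split=> //; apply: connect_trans zt.
  - by constructor 3; split=> //; apply: connect_trans zh.
case: xz => -[-> Ez]; subst z; case: (IHp _ zp yp) => [zy|[zt hy]|[zh ty]].
- by constructor 2.
- by constructor 2.
- by constructor 1.
- by constructor 3.
- by constructor 1.
- by constructor 3.
Qed.

(** The exchange property of the graphic matroid: the walk that spans [e] must use [f], and [e]
    closes its remainder to a detour around [f]. *)
Lemma spanned_exchange A e f :
  spanned (f |: A) e -> ~~ spanned A e -> spanned (e |: A) f.
Proof.
have sub x y : conn A x y -> conn (e |: A) x y.
  by apply: conn_mono; rewrite subsetUr.
have eP : spanned (e |: A) e by rewrite spanned_mem ?setU11.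
move=> /conn_setU1[eA /negP[]//|[tt hh]|[th ht]] _.
  apply: connect_trans (connect_trans eP _); first by rewrite conn_sym sub.
  by rewrite conn_sym sub.
rewrite /spanned conn_sym; apply: connect_trans (connect_trans eP _).
  by rewrite conn_sym sub.
by rewrite conn_sym sub.
Qed.

(** * Counting connected components *)

Definition component A x := [set y | conn A x y].
Definition components A := [set component A x | x in vertex G].

Lemma component_eq A x y : (component A x == component A y) = conn A x y.
Proof.
apply/eqP/idP => [/setP/(_ y)|xy]; first by rewrite !inE connect0.
by apply/setP => z; rewrite !inE; apply: (same_connect (@conn_sym A)).
Qed.

Lemma component_in A x : component A x \in components A.
Proof. exact: imset_f. Qed.

Lemma card_components_gt0 A x : 0 < #|components A|.
Proof. by apply/card_gt0P; exists (component A x); apply: component_in. Qed.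

Lemma component_reach A B x : (forall y z, conn A y z -> conn B y z) ->
  component B x = \bigcup_(y in component A x) component B y.
Proof.
move=> AB; apply/setP => z; rewrite inE; apply/idP/bigcupP => [xz|[y]].
  by exists x; rewrite !inE.
by rewrite !inE => /AB; apply: connect_trans.
Qed.

(** The coarser partition is an image of the finer one, so strict inequality of the counts is
    failure of injectivity. *)
Lemma components_reach A B : (forall y z, conn A y z -> conn B y z) ->
  components B = (fun S : {set _} => \bigcup_(y in S) component B y) @: components A.
Proof.
by move=> AB; rewrite -imset_comp; apply: eq_imset => x /=; apply: component_reach.
Qed.

Lemma card_components_le A B : (forall x y, conn A x y -> conn B x y) ->
  #|components B| <= #|components A|.
Proof. by move=> /components_reach ->; apply: leq_imset_card. Qed.

Lemma card_components_eq A B : connect (adj A) =2 connect (adj B) ->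
  #|components A| = #|components B|.
Proof.
by move=> AB; apply/eqP; rewrite eqn_leq !card_components_le // => x y; rewrite AB.
Qed.

Lemma card_components_setU1 A e : ~~ spanned A e ->
  #|components (e |: A)| < #|components A|.
Proof.
have AB y z : conn A y z -> conn (e |: A) y z.
  by apply: conn_mono; rewrite subsetUr.
apply: contraNltn => le.
have /imset_injP inj : #|(fun S : {set _} => \bigcup_(y in S) component (e |: A) y)
    @: components A| == #|components A|.
  by rewrite -(components_reach AB) eqn_leq le card_components_le.
rewrite /spanned -component_eq; apply/eqP/inj; rewrite ?component_in //.
rewrite -!component_reach //; apply/eqP; rewrite component_eq.
by apply: spanned_mem; rewrite setU11.
Qed.

(** Deleting the edges of [B] outside [A] one by one creates a new component each time, since
    independence passes to subsets. *)
Lemma card_components_indep A B : A \subset B ->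
  (forall f, f \in B -> ~~ spanned (B :\ f) f) ->
  #|B :\: A| + #|components B| <= #|components A|.
Proof.
elim: {B}_.+1 {-2}B (ltnSn #|B|) => // n IHn B leBn AB indep.
have [BA|[f]] := set_0Vmem (B :\: A).
  rewrite BA cards0; suff -> : B = A by [].
  by apply/eqP; rewrite eqEsubset AB andbT -setD_eq0 BA.
rewrite inE => /andP[fA fB]; have ABf : A \subset B :\ f by rewrite subsetD1 AB.
have lt : #|components B| < #|components (B :\ f)|.
  by rewrite -[in X in X < _](setD1K fB); apply/card_components_setU1/indep.
have := cardsD1 f (B :\: A); rewrite inE fA fB.
have -> : (B :\: A) :\ f = (B :\ f) :\: A by rewrite !setDDl setUC.
have := cardsD1 f B; rewrite fB => cB.
have : #|(B :\ f) :\: A| + #|components (B :\ f)| <= #|components A|; last by lia.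
apply: IHn => // [|g]; first by lia.
rewrite inE => /andP[gf gB]; apply: contra (indep g gB).
by apply: conn_mono; rewrite setSD // subD1set.
Qed.

End Connectivity.

(** * Disjoint connected spanning edge sets *)

Section Packing.
Variables (G : mgraph) (D : orientation G) (k : nat).
Implicit Types (A B C : {set edge G}) (e f : edge G) (c : {ffun edge G -> option 'I_k}).

(** By minimality [C :\ f] does not span [e], so by exchange [e |: (C :\ f)] spans [f]. *)
Lemma exchange_conn A C e f : minset ((spanned D)^~ e) C -> f \in C -> C \subset A ->
  connect (adj (e |: (A :\ f))) =2 connect (adj A).
Proof.
move=> /minsetP[Ce minC] fC CA x y; apply/idP/idP; apply: (conn_span (D := D)) => g.
  rewrite !inE => /predU1P[->|/andP[_ gA]]; last exact: spanned_mem.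
  exact: conn_mono CA Ce.
have [->|gf] := eqVneq g f => gA; last by apply: spanned_mem; rewrite !inE gf gA orbT.
have : spanned D (e |: (C :\ f)) f.
  apply: spanned_exchange; first by rewrite setD1K.
  apply/negP => /minC/(_ (subD1set _ _))/setP/(_ f).
  by rewrite !inE eqxx fC.
by apply: conn_mono; rewrite setUS // setSD.
Qed.

(** * Partial colourings and exchanges *)

Definition color_class c i := [set e | c e == Some i].

(* The weight 2 makes both coloring an uncolored edge that joins two components
   and uncoloring a redundant edge strictly profitable. *)
Definition cost c :=
  \sum_i (2 * #|components (color_class c i)| + #|color_class c i|).

Definition optimal c := [forall c', cost c <= cost c'].

Definition recolor c e o : {ffun edge G -> option 'I_k} :=
  [ffun x => if x == e then o else c x].

Definition swap c e f : {ffun edge G -> option 'I_k} :=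
  [ffun x => if x == e then c f else if x == f then None else c x].

(** A boolean relation on a finite type, so that [connect] gives its reflexive transitive
    closure. *)
Definition exchange : rel {ffun edge G -> option 'I_k} := fun c c' =>
  [exists p : edge G * edge G * 'I_k * {set edge G},
    let: (e, f, i, C) := p in
    [&& c e == None, minset ((spanned D)^~ e) C, C \subset color_class c i,
        f \in C & c' == swap c e f]].

Lemma exchangeP c c' :
  reflect (exists e f i C,
             [/\ c e = None, minset ((spanned D)^~ e) C,
                 C \subset color_class c i, f \in C & c' = swap c e f])
          (exchange c c').
Proof.
apply: (iffP existsP) => [[[[[e f] i] C]] /and5P[/eqP ? ? ? ? /eqP ?]|].
  by exists e, f, i, C.
by move=> [e [f [i [C [/eqP ? ? ? ? /eqP ?]]]]]; exists (e, f, i, C); apply/and5P.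
Qed.

Lemma swap_class c e f i j : c e = None -> c f = Some i ->
  color_class (swap c e f) j =
  if j == i then e |: (color_class c i :\ f) else color_class c j.
Proof.
move=> ce cf; case: (eqVneq j i) => [->|ji]; apply/setP => x; rewrite !inE ffunE.
  by have [_|_] := eqVneq x e; have [_|_] := eqVneq x f; rewrite ?cf ?eqxx.
have ij : (Some i == Some j) = false by apply/eqP => -[ij]; rewrite ij eqxx in ji.
have [->|_] := eqVneq x e; first by rewrite cf ce ij.
by have [->|//] := eqVneq x f; rewrite cf ij.
Qed.

(** The class that trades [f] for [e] keeps both its connectivity and its size. *)
Lemma swap_cost c e f i C : c e = None -> minset ((spanned D)^~ e) C ->
  C \subset color_class c i -> f \in C -> cost (swap c e f) = cost c.
Proof.
move=> ce Ce Ci fC; have := subsetP Ci f fC; rewrite inE => /eqP cf.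
apply: eq_bigr => j _; rewrite (swap_class _ ce cf).
case: eqVneq => // ->; congr (2 * _ + _).
  exact/card_components_eq/(exchange_conn Ce).
by rewrite cardsU1 !inE ce andbF add1n [RHS](cardsD1 f) inE cf eqxx.
Qed.

Lemma exchange_optimal c c' : connect exchange c c' -> optimal c -> optimal c'.
Proof.
case/connectP=> p; elim: p c => [|d p IHp] c /=; first by move=> _ ->.
case/andP=> /exchangeP[e [f [i [C [ce Ce Ci fC ->]]]]] dp cp /forallP oc.
by apply: IHp dp cp _; apply/forallP => c0; rewrite (swap_cost ce Ce Ci fC).
Qed.

Lemma cost_recolor c c' i :
  (forall j, j != i -> color_class c' j = color_class c j) ->
  2 * #|components (color_class c' i)| + #|color_class c' i| <
  2 * #|components (color_class c i)| + #|color_class c i| ->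
  cost c' < cost c.
Proof.
move=> eqj lt; rewrite /cost (bigD1 i) //= [ltnRHS](bigD1 i) //=.
rewrite (eq_bigr (fun j => 2 * #|components (color_class c j)| + #|color_class c j|)).
  by rewrite ltn_add2r.
by move=> j /eqj ->.
Qed.

Lemma optimal_spanned c e i : optimal c -> c e = None -> spanned D (color_class c i) e.
Proof.
move=> /forallP oc ce; apply: contraT => ne.
have := oc (recolor c e (Some i)); rewrite leqNgt => /negP[].
have Ei : color_class (recolor c e (Some i)) i = e |: color_class c i.
  by apply/setP => x; rewrite !inE ffunE; have [_|//] := eqVneq x e; rewrite eqxx.
apply: (@cost_recolor _ _ i) => [j ji|].
  apply/setP => x; rewrite !inE ffunE; have [->|//] := eqVneq x e.
  by rewrite ce; apply/eqP => -[ij]; rewrite ij eqxx in ji.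
rewrite Ei cardsU1 inE ce /=; move: (card_components_setU1 ne).
by set a := #|_|; set b := #|_|; lia.
Qed.

Lemma optimal_indep c f i : optimal c -> f \in color_class c i ->
  ~~ spanned D (color_class c i :\ f) f.
Proof.
move=> /forallP oc fi; apply/negP => sf.
have := oc (recolor c f None); rewrite leqNgt => /negP[].
have E j : color_class (recolor c f None) j = color_class c j :\ f.
  by apply/setP => x; rewrite !inE ffunE; case: (eqVneq x f).
have cf : c f = Some i by move: fi; rewrite inE => /eqP.
apply: (@cost_recolor _ _ i) => [j ji|].
  rewrite E; apply/setP => x; rewrite !inE; have [->|//] := eqVneq x f.
  by rewrite cf; apply/esym/eqP => -[ij]; rewrite ij eqxx in ji.
rewrite E [X in _ < _ + X](cardsD1 f) fi.
suff -> : #|components (color_class c i :\ f)| = #|components (color_class c i)| by lia.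
apply: card_components_eq => x y; apply/idP/idP; apply: (conn_span (D := D)) => g.
  by rewrite inE => /andP[_]; apply: spanned_mem.
by have [->//|gf] := eqVneq g f => gi; apply: spanned_mem; rewrite in_setD1 gf.
Qed.

(** * Edges that exchanges can release *)

Definition releasable c :=
  [set e | [exists c', connect exchange c c' && (c' e == None)]].

Lemma releasableP c e :
  reflect (exists2 c', connect exchange c c' & c' e = None) (e \in releasable c).
Proof.
rewrite inE; apply: (iffP existsP) => [[c' /andP[cc' /eqP e0]]|[c' cc' /eqP e0]].
  by exists c'.
by exists c'; rewrite cc'.
Qed.

Lemma minset_releasable c c' e i C : connect exchange c c' -> c' e = None ->
  minset ((spanned D)^~ e) C -> C \subset color_class c' i -> C \subset releasable c.
Proof.
move=> cc' ce Ce Ci; apply/subsetP => f fC; apply/releasableP.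
exists (swap c' e f); first apply: connect_trans cc' _.
  by apply/connect1/exchangeP; exists e, f, i, C.
rewrite ffunE eqxx; case: eqVneq => // fe.
by have := subsetP Ci f fC; rewrite inE fe ce.
Qed.

(** Each exchange takes place inside [releasable c], which contains [e] and all of [C]; hence the
    restricted class also trades [f] for [e] without changing connectivity. *)
Lemma exchange_releasable c c' i : connect exchange c c' ->
  connect (adj (color_class c' i :&: releasable c)) =2
  connect (adj (color_class c i :&: releasable c)).
Proof.
case/connectP=> p; elim/last_ind: p c' => [|p d IHp] c' /=; first by move=> _ ->.
rewrite rcons_path last_rcons => /andP[cp /exchangeP[e [f [j [C [ce Ce Cj fC Ed]]]]]] ->.
have reach : connect exchange c (last c p) by apply/connectP; exists p.
move=> x y; rewrite -(IHp _ cp erefl) Ed.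
have cf : last c p f = Some j by have := subsetP Cj f fC; rewrite inE => /eqP.
rewrite (swap_class _ ce cf); case: (eqVneq i j) => // ->.
have Cr := minset_releasable reach ce Ce Cj.
have er : e \in releasable c by apply/releasableP; exists (last c p).
have -> : (e |: (color_class (last c p) j :\ f)) :&: releasable c =
          e |: ((color_class (last c p) j :&: releasable c) :\ f).
  by apply/setP => g; rewrite !in_setI !in_setU1 !in_setD1 in_setI;
     case: (eqVneq g e) => [->|_]; rewrite ?er // -andbA.
by apply: (exchange_conn Ce); rewrite // subsetI Cj.
Qed.

(** At a colouring where [e] is uncoloured, optimality gives a minimal [C] of colour [i] spanning
    [e], and [C] is releasable; [exchange_releasable] carries this back to [c]. *)
Lemma releasable_spanned c e i : optimal c -> e \in releasable c ->
  spanned D (color_class c i :&: releasable c) e.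
Proof.
move=> oc /releasableP[c' cc' e0].
have [C Ce Ci] := @minset_exists _ ((spanned D)^~ e) _
  (optimal_spanned i (exchange_optimal cc' oc) e0).
have Cr := minset_releasable cc' e0 Ce Ci; case/minsetP: Ce => Ce _.
by rewrite /spanned -(exchange_releasable i cc'); apply: conn_mono Ce; rewrite subsetI Ci.
Qed.

(* Every component is left by at least 2k edges, and each edge that joins two
   components leaves exactly two of them. *)
Lemma edge_connected_crossing A : edge_connected G (2 * k) -> 1 < #|components A| ->
  k * #|components A| <= #|[set e | ~~ spanned D A e]|.
Proof.
move=> econn comps.
(* Both sides are doubled to count pairs of a component and an edge leaving it; [lv S] is the edge
   cut of [S]. *)
rewrite -(leq_pmul2l (ltn0Sn 1)) mulnA.
pose lv (S : {set vertex G}) := [set e | (arc_tail D e \in S) != (arc_head D e \in S)].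
have lvS S : S \in components A -> 2 * k <= #|lv S|.
  (* If the cut were smaller, deleting it would leave the graph connected, although [S] is then
     closed under adjacency and misses some [y]. *)
  case/imsetP=> x _ ES; rewrite leqNgt; apply/negP => /econn conn.
  have [y xy] : exists y, ~~ connect (adj A) x y.
    apply/existsP; apply: contraLR comps; rewrite negb_exists => /forallP all.
    suff -> : components A = [set component A x] by rewrite cards1.
    apply/setP => Z; rewrite inE; apply/imsetP/eqP => [[y _ ->]|->]; last by exists x.
    by apply/eqP; rewrite component_eq conn_sym; have := all y; rewrite negbK.
  have : connect (adj (~: lv S)) x y by apply: conn.
  suff cl : fingraph.closed (adj (~: lv S)) S.
    by move/(closed_connect cl); rewrite ES !inE connect0 (negPf xy).
  move=> a b /(adjP D)[e]; rewrite !inE negbK => /eqP E.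
  by case=> -[-> ->].
have : \sum_(S in components A) 2 * k <= \sum_(S in components A) #|lv S|.
  exact: leq_sum.
rewrite sum_nat_const mulnC => /leq_trans; apply.
have -> : \sum_(S in components A) #|lv S| =
          \sum_e \sum_(S in components A) (e \in lv S).
  rewrite exchange_big; apply: eq_bigr => S _.
  by rewrite -sum1_card big_mkcond; apply: eq_bigr => e _; case: (_ \in _).
rewrite -sum1_card big_distrr /= big_mkcond [leqRHS]big_mkcond /=.
apply: leq_sum => e _.
have inS S z : S \in components A -> (z \in S) = (S == component A z).
  by case/imsetP=> x _ ->; rewrite component_eq inE.
case: ifPn => [_|].
  apply: leq_trans (_ : \sum_(S in components A)
     ((S == component A (arc_tail D e)) + (S == component A (arc_head D e))) <= _).
    by apply: leq_sum => S SA; rewrite inE !inS //; do 2!case: (S == _).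
  have one z : \sum_(S in components A) (S == component A z) = 1.
    rewrite (bigD1 (component A z)) ?component_in //= eqxx big1 // => S.
    by case/andP=> _ /negPf->.
  by rewrite big_split /= !one.
rewrite inE negbK => sp; rewrite leqn0 sum_nat_eq0; apply/forall_inP => S SA.
have /eqP E : component A (arc_tail D e) == component A (arc_head D e).
  by rewrite component_eq.
by rewrite inE !inS // E eqxx.
Qed.

Theorem edge_connected_packing : 0 < k -> edge_connected G (2 * k) ->
  exists T : 'I_k -> {set edge G},
    (forall i, connected_by (T i)) /\ (forall i j, i != j -> [disjoint T i & T j]).
Proof.
move=> k0 econn; pose c0 : {ffun edge G -> option 'I_k} := [ffun=> None].
have [c oc] : exists c, optimal c.
  case: (@arg_minnP _ c0 xpredT cost isT) => c _ min; exists c; apply/forallP => c'.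
  exact: min.
exists (color_class c); split=> [i|i j ij]; last first.
  rewrite -setI_eq0; apply/eqP/setP => e; rewrite !inE.
  by apply/negP => /andP[/eqP -> /eqP[] E]; rewrite E eqxx in ij.
pose E0 := releasable c.
have spanE0 j : connect (adj (color_class c j :&: E0)) =2 connect (adj E0).
  move=> x y; apply/idP/idP; first by apply: conn_mono; rewrite subsetIr.
  by apply: (conn_span (D := D)) => e; apply: releasable_spanned.
move=> x y; suff: connect (adj E0) x y.
  by rewrite -(spanE0 i); apply: conn_mono; rewrite subsetIl.
apply: contraT => nxy.
have q1 : 1 < #|components E0|.
  rewrite (cardsD1 (component E0 x)) component_in (cardsD1 (component E0 y)).
  by rewrite in_setD1 component_in component_eq conn_sym nxy.
have := edge_connected_crossing econn q1; rewrite leqNgt => /negP[].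
(* Class [j] is independent, and its part in [E0] has the same components as [E0], so each edge of
   the class outside [E0] merges two of them. *)
have classes j : #|color_class c j :\: E0| < #|components E0|.
  rewrite -(card_components_eq (spanE0 j)).
  have -> : color_class c j :\: E0 = color_class c j :\: (color_class c j :&: E0).
    by rewrite setDIr setDv set0U.
  have := @card_components_indep _ D (color_class c j :&: E0) (color_class c j)
    (subsetIl _ _) (fun f => @optimal_indep c f j oc).
  by apply: leq_trans; rewrite -[ltnLHS]addn0 -addnS leq_add2l (card_components_gt0 _ x).
(* An edge joining two components is not releasable, hence coloured, so some class counts it. *)
apply: (@leq_ltn_trans (\sum_j #|color_class c j :\: E0|)).
  apply: leq_trans (_ : #|\bigcup_j (color_class c j :\: E0)| <= _).
    apply/subset_leq_card/subsetP => e; rewrite inE => ne.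
    have eE0 : e \notin E0 by apply: contra ne; apply: spanned_mem.
    case Ee: (c e) => [j|].
      by apply/bigcupP; exists j; rewrite // in_setD eE0 inE Ee eqxx.
    by case/negP: eE0; apply/releasableP; exists c.
  elim/big_rec2: _ => [|j m A _ IH]; first by rewrite cards0.
  by apply: leq_trans (leq_card_setU _ _) _; rewrite leq_add2l.
have : \sum_(j < k) (#|color_class c j :\: E0| + 1) <= \sum_(j < k) #|components E0|.
  by apply: leq_sum => j _; rewrite addn1.
rewrite big_split /= !sum_nat_const card_ord muln1; apply: leq_trans.
by rewrite -[ltnLHS]addn0 ltn_add2l.
Qed.

End Packing.

(** * Flows with prescribed boundary and Eulerian orientations *)

Import Order.TTheory GRing.Theory Num.Theory.
Local Open Scope ring_scope.

Section NetOutflow.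
Variables (V E : finType) (A : zmodType).
Implicit Types (t h : E -> V) (f g : E -> A).

(** The group is arbitrary: [bool], with exclusive or, handles parities, [int] orientations, and the
    reals perturbations. *)
Definition outflow t h f v : A := \sum_e (f e *+ (t e == v) - f e *+ (h e == v)).

Lemma outflowD t h f g v :
  outflow t h (fun e => f e + g e) v = outflow t h f v + outflow t h g v.
Proof.
by rewrite -big_split; apply: eq_bigr => e _; rewrite !mulrnDl opprD addrACA.
Qed.

Lemma outflow_total t h f : \sum_v outflow t h f v = 0.
Proof.
rewrite exchange_big big1 // => e _; rewrite big_split /= sumrN.
suff one (z : V) : \sum_v f e *+ (z == v) = f e by rewrite !one subrr.
by rewrite (bigD1 z) //= eqxx big1 ?addr0 // => v /negPf; rewrite eq_sym => ->.
Qed.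

Lemma outflow1 t h e (a : A) v :
  outflow t h (fun x => a *+ (x == e)) v = a *+ (t e == v) - a *+ (h e == v).
Proof.
rewrite /outflow (bigD1 e) //= eqxx big1 ?addr0 // => x /negPf->.
by rewrite !mul0rn subrr.
Qed.

Lemma outflow0 t h v : outflow t h (fun=> 0 : A) v = 0.
Proof. by rewrite /outflow big1 // => e _; rewrite !mul0rn subrr. Qed.

Lemma eq_outflow t h f g v : f =1 g -> outflow t h f v = outflow t h g v.
Proof. by move=> fg; apply: eq_bigr => e _; rewrite fg. Qed.

Lemma outflow_rehead t h f e z v :
  outflow t (fun x => if x == e then z else h x) f v + f e *+ (z == v) =
  outflow t h f v + f e *+ (h e == v).
Proof.
rewrite /outflow (bigD1 e) //= [in RHS](bigD1 e) //= eqxx.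
rewrite [LHS]addrAC [RHS]addrAC !subrK; congr (_ + _).
by apply: eq_bigr => x /negPf->.
Qed.

End NetOutflow.

Lemma boundary_outflow (R : realType) (G : mgraph) (D : orientation G)
    (f : edge G -> R) v :
  boundary D f v = outflow (arc_tail D) (arc_head D) f v.
Proof.
rewrite /boundary /outflow big_split /= sumrN big_mkcond [in X in _ - X]big_mkcond.
by congr (_ - _); apply: eq_bigr => e _; case: eqP.
Qed.

(** * Routing demands inside a connected edge set *)

Section Demand.
Variables (G : mgraph) (D : orientation G) (A : zmodType) (T : {set edge G}).
Local Notation out := (outflow (arc_tail D) (arc_head D)).

Lemma connect_demand x y (a : A) : connect (adj T) x y ->
  exists2 g : edge G -> A, forall e, e \notin T -> g e = 0 &
    forall v, out g v = a *+ (x == v) - a *+ (y == v).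
Proof.
case/connectP=> p; elim: p x => [|z p IHp] x /=.
  by move=> _ ->; exists (fun=> 0) => // v; rewrite subrr outflow0.
case/andP=> /(adjP D)[e eT xz] zp /(IHp _ zp)[g gT gv].
pose b := if x == arc_tail D e then a else - a.
exists (fun e' => b *+ (e' == e) + g e') => [e' e'T|v].
  by rewrite gT // (_ : (e' == e) = false) ?addr0 //; apply: contraNF e'T => /eqP->.
rewrite outflowD gv outflow1.
rewrite /b; case: xz => -[-> ->]; first by rewrite eqxx addrA subrK.
case: eqVneq => [->|_]; first by rewrite subrr add0r.
by rewrite !mulNrn opprK [- _ + _]addrC addrA subrK.
Qed.

(** Route [d v] from each [v] to a fixed root; the excess arriving at the root is the total of [d],
    which is zero. *)
Lemma connected_demand (d : vertex G -> A) : connected_by T -> \sum_v d v = 0 ->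
  exists2 g : edge G -> A, forall e, e \notin T -> g e = 0 & forall v, out g v = d v.
Proof.
move=> conn d0; case: (pickP (vertex G)) => [r _|V0]; last first.
  by exists (fun=> 0) => // v; have := V0 v.
have [g gT gv] : exists2 g : edge G -> A, forall e, e \notin T -> g e = 0 &
    forall w, out g w = \sum_v (d v *+ (v == w) - d v *+ (r == w)).
  elim: (index_enum _) => [|v s [g gT gv]].
    by exists (fun=> 0) => // w; rewrite big_nil outflow0.
  have [g1 g1T g1v] := connect_demand (d v) (conn v r).
  exists (fun e => g1 e + g e) => [e eT|w]; first by rewrite g1T ?gT ?addr0.
  by rewrite outflowD g1v gv big_cons.
exists g => // w; rewrite gv big_split /= sumrN [in X in _ - X]sumrMnl d0 mul0rn subr0.
by rewrite (bigD1 w) //= eqxx big1 ?addr0 // => v /negPf->.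
Qed.

End Demand.

(* Splitting off: the edges e = xy and e' = yz are replaced by one edge xz that
   reuses the name e; orienting it orients both consistently. Loops can arise, so
   the statement is about arbitrary end maps t and h. *)
Lemma eulerian_orientation (V E : finType) (K : {set E}) (t h : E -> V) :
  (forall v, outflow t h (fun e => e \in K) v = 0) ->
  exists2 s : E -> int, forall e, `|s e| = (e \in K)%:R & forall v, outflow t h s v = 0.
Proof.
elim: {K}_.+1 {-2}K (ltnSn #|K|) t h => // n IHn K leKn t h even.
have [->|[e eK]] := set_0Vmem K.
  exists (fun=> 0) => [e|v]; first by rewrite inE normr0.
  by rewrite /outflow big1 // => e _; rewrite !mul0rn subrr.
have ltD1 e' : e' \in K -> (#|K :\ e'| < n)%N.
  by move=> e'K; rewrite (cardsD1 e') e'K in leKn.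
have indD1 e' v : e' \in K -> outflow t h (fun f => f \in K :\ e') v =
    - (true *+ (t e' == v) - true *+ (h e' == v)).
  move=> e'K; apply/eqP; rewrite -addr_eq0 -outflow1 -outflowD -[X in _ == X](even v).
  apply/eqP/eq_outflow => f; rewrite !inE.
  have [->|_] := eqVneq f e'; first by rewrite e'K.
  by rewrite addr0.
have [loop|nloop] := eqVneq (t e) (h e).
  have [v|s sK s0] := IHn (K :\ e) (ltD1 e eK) t h.
    by rewrite indD1 // loop subrr oppr0.
  exists (fun f => s f + 1 *+ (f == e)) => [f|v].
    have := sK f; rewrite !inE; have [->|_] := eqVneq f e; last by rewrite addr0.
    by move=> /eqP; rewrite normr_eq0 eK => /eqP->; rewrite add0r normr1.
  by rewrite outflowD s0 add0r outflow1 loop subrr.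
(* The head of [e] has even degree in [K] and [e] is no loop, so another edge of [K], itself no
   loop, ends there. *)
have [e' [e'K e'e inc]] :
    exists e', [/\ e' \in K, e' != e & (t e' == h e) != (h e' == h e)].
  have /negP : outflow t h (fun f => f \in K :\ e) (h e) != 0.
    by rewrite indD1 // (negPf nloop) eqxx.
  case: (boolP [exists f, [&& f \in K, f != e & (t f == h e) != (h f == h e)]]).
    by case/existsP=> f /and3P[]; exists f.
  rewrite negb_exists => /forallP all []; apply/eqP/big1 => f _.
  have := all f; rewrite !inE; case: (f \in K); case: (f != e);
    rewrite ?mul0rn ?subrr //=.
  by rewrite negbK => /eqP->; rewrite subrr.
(* [z] is the far end of [e'], and [sg] is the sign with which [e'] continues [e] through its
   head. *)
pose z := if t e' == h e then h e' else t e'.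
pose sg : int := if t e' == h e then 1 else -1.
pose h' x := if x == e then z else h x.
have move_bool v : true *+ (t e' == v) - true *+ (h e' == v) =
                   true *+ (h e == v) - true *+ (z == v) :> bool.
  rewrite /z; case: (eqVneq (t e') (h e)) inc => [->//|_].
  rewrite eq_sym eqbF_neg negbK => /eqP ->.
  by case: (t e' == v); case: (h e == v).
have move_int (a : int) v : (sg * a) *+ (t e' == v) - (sg * a) *+ (h e' == v) =
                   a *+ (h e == v) - a *+ (z == v).
  rewrite /z /sg; case: (eqVneq (t e') (h e)) inc => [->|_]; first by rewrite mul1r.
  rewrite eq_sym eqbF_neg negbK => /eqP ->.
  by rewrite mulN1r !mulNrn opprK addrC.
have [v|s sK s0] := IHn (K :\ e') (ltD1 e' e'K) t h'.
  have := outflow_rehead t h (fun f => f \in K :\ e') e z v.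
  rewrite -/h' indD1 // move_bool !inE eq_sym e'e eK /=.
  by case: (outflow _ _ _ _); case: (h e == v); case: (z == v).
have se' : s e' = 0 by apply/eqP; rewrite -normr_eq0 sK !inE eqxx.
exists (fun f => s f + (sg * s e) *+ (f == e')) => [f|v].
  have [->|fe'] := eqVneq f e'; last by rewrite addr0 sK !inE fe'.
  rewrite se' add0r normrM sK !inE eq_sym e'e eK e'K mulr1 /sg.
  by case: ifP.
rewrite outflowD outflow1 move_int; have := outflow_rehead t h s e z v.
by rewrite -/h' s0 add0r => ->; rewrite addrA subrr.
Qed.

(** * Circular flows with period below 4 *)

Lemma outflow_intr (V E : finType) (R : pzRingType) (t h : E -> V) (s : E -> int) v :
  outflow t h (fun e => (s e)%:~R : R) v = (outflow t h s v)%:~R.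
Proof.
by rewrite rmorph_sum; apply: eq_bigr => e _; rewrite rmorphB !rmorphMn.
Qed.

Lemma outflowZ (V E : finType) (R : pzRingType) (t h : E -> V) (x : R) (f : E -> R) v :
  outflow t h (fun e => x * f e) v = x * outflow t h f v.
Proof. by rewrite mulr_sumr; apply: eq_bigr => e _; rewrite mulrBr !mulrnAr. Qed.

Lemma normz_eq01 (s : int) (b : bool) : `|s| = b%:R ->
  if b then s = 1 \/ s = -1 else s = 0.
Proof. by case: b => /=; lia. Qed.

Lemma normr_pm (R : realType) (x p : R) : 0 <= p -> x = p \/ x = - p -> `|x| = p.
Proof. by move=> p0 [->|->]; rewrite ?normrN ger0_norm. Qed.

Section Flow.
Variables (G : mgraph) (D : orientation G).
Local Notation out := (outflow (arc_tail D) (arc_head D)).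

(** Over [bool], the degree parities of [X] form a demand of total zero; toggling [X] along a flow
    in [T] that meets it makes all degrees even. *)
Lemma parity_join (T X : {set edge G}) : connected_by T ->
  exists2 K : {set edge G}, forall v, out (fun e => e \in K) v = 0 &
    forall e, e \notin T -> (e \in K) = (e \in X).
Proof.
move=> conn; have tot : \sum_v - out (fun e => e \in X) v = 0.
  by rewrite sumrN outflow_total oppr0.
have [j jT jX] := connected_demand D conn tot.
exists [set e | (e \in X) + j e] => [v|e eT]; last by rewrite inE jT ?addr0.
rewrite -[RHS](subrr (out (fun e => e \in X) v)) -jX -outflowD.
by apply: eq_outflow => e; rewrite inE.
Qed.

(* w is the direction in which an odd value of F has to move, relative to the scaled
   flow r/4 F, when the period r shrinks below 4. *)
Lemma integer_flow (sigma : edge G -> sign) (T0 T1 T2 : {set edge G}) :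
  connected_by T0 -> connected_by T1 ->
  [disjoint T0 & T1] -> [disjoint T0 & T2] -> [disjoint T1 & T2] ->
  exists F w : edge G -> int,
    [/\ forall v, out F v = 0,
        forall e, match sigma e with
          | Pos => (F e = 1 \/ F e = -3) /\ w e = 1 \/
                   (F e = -1 \/ F e = 3) /\ w e = -1 \/
                   (F e = 2 \/ F e = -2) /\ w e = 0
          | Neg => (F e = 1 \/ F e = -3) /\ w e = -1 \/
                   (F e = -1 \/ F e = 3) /\ w e = 1 \/
                   F e = 0 /\ w e = 0
          end
      & forall e, e \in T2 -> w e = 0].
Proof.
move=> conn0 conn1 /disjointFr d01 d02 d12.
have [H evenH HT1] := parity_join T0 conn1.
have T0H e : e \in T0 -> e \in H by move=> e0; rewrite HT1 ?d01.
have T2H e : e \in T2 -> e \notin H.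
  by move=> e2; rewrite HT1 ?(disjointFl d02) ?(disjointFl d12).
pose pos e := if sigma e is Pos then true else false.
(* Repairs occur only in [T0], inside [H], so outside [H] the set [K] consists of exactly the
   positive edges. *)
have [K evenK KT0] := parity_join [set e | pos e && (e \notin H)] conn0.
have KH e : e \notin H -> (e \in K) = pos e.
  by move=> eH; rewrite KT0 ?inE ?eH ?andbT //; apply: contra eH; apply: T0H.
have [a aH a0] := eulerian_orientation evenH.
have [b bK b0] := eulerian_orientation evenK.
(* On [H], modulo 4, [a + 2b] is [- a] on edges of [K] and [a] elsewhere. This residue is the
   direction wanted on positive edges and the opposite of the one on negative edges, hence the
   single test. *)
exists (fun e => a e + (b e + b e)), (fun e => if pos e == (e \in K) then - a e else a e).
split=> [v|e|e /T2H eH]; first by rewrite !outflowD a0 b0.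
  have := normz_eq01 (aH e); have := normz_eq01 (bK e); have := KH e; rewrite /pos.
  case: (sigma e); case: (e \in H); case: (e \in K) => //= KHe;
    try (by have := KHe isT); lia.
by have := aH e; rewrite (negPf eH) => /normr0_eq0->; rewrite oppr0 if_same.
Qed.

End Flow.

Lemma exists_circular_flow (R : realType) (G : mgraph) (sigma : edge G -> sign)
    (T0 T1 T2 : {set edge G}) :
  connected_by T0 -> connected_by T1 -> connected_by T2 ->
  [disjoint T0 & T1] -> [disjoint T0 & T2] -> [disjoint T1 & T2] ->
  exists r : R, 2 <= r < 4 /\
    exists (D : orientation G) (f : edge G -> R), circular_flow sigma r D f.
Proof.
move=> conn0 conn1 conn2 d01 d02 d12; have [D] := orientation_exists G.
have [F [w [F0 Fw wT2]]] := integer_flow D sigma conn0 conn1 d01 d02 d12.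
pose out := outflow (A := R) (arc_tail D) (arc_head D).
have tot : \sum_v - out (fun e => (w e)%:~R) v = 0.
  by rewrite sumrN outflow_total oppr0.
have [g2 g2T g2w] := connected_demand D conn2 tot.
(* Since [w] vanishes on [T2], cancelling its outflow by [g2] inside [T2] leaves its nonzero values
   intact. *)
have {g2w wT2 tot} [g g0 gw] : exists2 g : edge G -> R, forall v, out g v = 0 &
    forall e, w e != 0 -> g e = (w e)%:~R.
  exists (fun e => (w e)%:~R + g2 e) => [v|e we].
    by rewrite /out outflowD g2w subrr.
  by rewrite g2T ?addr0 //; apply: contra we => /wT2->.
(* With [d] the inverse of [M], [d * g e] is at most 1 in absolute value; the summand 1 ensures
   [d <= 1]. *)
pose M : R := 1 + \sum_e `|g e|.
have sum_ge0 : 0 <= \sum_e `|g e| by apply: sumr_ge0.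
have gM e : `|g e| <= M.
  by rewrite /M (bigD1 e) //= addrCA lerDl addr_ge0 // sumr_ge0.
have M1 : 1 <= M by rewrite lerDl.
pose d := M^-1; have d0 : 0 < d by rewrite invr_gt0; lra.
have d1 : d <= 1 by rewrite invf_le1; lra.
pose f e : R := (4 - d) / 4 * (F e)%:~R + d / 4 * g e.
have dg e : -1 <= d * g e <= 1.
  rewrite -ler_norml normrM gtr0_norm // mulrC ler_pdivrMr ?mul1r //; lra.
exists (4 - d); split; first by apply/andP; split; lra.
exists D, f.
(* For odd [F e] the shift lands exactly on an end of the allowed range: [1] or [3 - d] in absolute
   value on positive edges, [1 - d / 2] or [3 - d / 2] on negative ones. For even [F e] a shift of
   at most 1/4 stays in range. *)
have Hf e : match sigma e return Prop with
    | Pos => 1 <= `|f e| <= 4 - d - 1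
    | Neg => 0 <= `|f e| <= (4 - d) / 2 - 1 \/ (4 - d) / 2 + 1 <= `|f e| < 4 - d
    end.
  have := Fw e; have := dg e; have := gw e; rewrite /f.
  case: (sigma e) => ge dge.
    case=> [[Fe we]|[[Fe we]|[Fe _]]].
    - rewrite ge we //; case: Fe => ->.
      + by rewrite (@normr_pm _ _ 1); [lra|lra|left; lra].
      + by rewrite (@normr_pm _ _ (3 - d)); [lra|lra|right; lra].
    - rewrite ge we //; case: Fe => ->.
      + by rewrite (@normr_pm _ _ 1); [lra|lra|right; lra].
      + by rewrite (@normr_pm _ _ (3 - d)); [lra|lra|left; lra].
    - case: Fe => ->; [rewrite ger0_norm|rewrite ler0_norm]; lra.
  case=> [[Fe we]|[[Fe we]|[-> _]]].
  - rewrite ge we //; case: Fe => ->.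
    + by left; rewrite (@normr_pm _ _ (1 - d / 2)); [lra|lra|left; lra].
    + by right; rewrite (@normr_pm _ _ (3 - d / 2)); [lra|lra|right; lra].
  - rewrite ge we //; case: Fe => ->.
    + by left; rewrite (@normr_pm _ _ (1 - d / 2)); [lra|lra|right; lra].
    + by right; rewrite (@normr_pm _ _ (3 - d / 2)); [lra|lra|left; lra].
  - left; rewrite normr_ge0 ler_norml; lra.
split=> // [e|v].
  by rewrite -ltr_norml; have := Hf e; case: (sigma e) => [|[]]; lra.
rewrite boundary_outflow /f outflowD !outflowZ outflow_intr F0 -/out g0.
by rewrite !mulr0 addr0.
Qed.

Lemma circular_flow_index_lt4 (R : realType) (G : mgraph) (sigma : edge G -> sign)
    (T : 'I_3 -> {set edge G}) :
  (forall i, connected_by (T i)) -> (forall i j, i != j -> [disjoint T i & T j]) ->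
  (circular_flow_index R sigma < 4%:E)%E.
Proof.
move=> conn disj.
have d (i j : nat) : (i < 3)%N -> (j < 3)%N -> i != j ->
    [disjoint T (inord i) & T (inord j)].
  by move=> i3 j3 ij; apply: disj; rewrite -val_eqE /= !inordK.
have [r [/andP[r2 r4] Df]] := exists_circular_flow R sigma
  (conn (inord 0)) (conn (inord 1)) (conn (inord 2))
  (d 0 1 isT isT isT) (d 0 2 isT isT isT) (d 1 2 isT isT isT).
apply: le_lt_trans (_ : (r%:E < 4%:E)%E); last by rewrite lte_fin.
by apply: ereal_inf_lbound; exists r.
Qed.

Theorem theorem5p7 (R : realType) :
  (forall (G : mgraph) (sigma : edge G -> sign),
      has_disjoint_spanning_trees G 3 ->
      (circular_flow_index R sigma < 4%:E)%E) /\
  (forall (G : mgraph) (sigma : edge G -> sign),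
      edge_connected G 6 ->
      (circular_flow_index R sigma < 4%:E)%E).
Proof.
split=> G sigma.
  by case=> T [tree disj]; apply: circular_flow_index_lt4 disj => i; case: (tree i).
have [D] := orientation_exists G.
case/(edge_connected_packing D (k := 3) isT) => T [conn disj].
exact: circular_flow_index_lt4 disj.
Qed.
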